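(* Let $G$ be a prime $(P_5,\overline{P_5},C_5)$-free graph which contains an induced Bull. Then $G$ is $(P_5,\overline{P_5},Bull)$-sparse if and only if $G$ or $\overline{G}$ is isomorphic to a graph of one of the four types $G_1,G_2,G_3,G_4$ described in the context.
   Context: All graphs are finite, simple and undirected; $\overline{G}$ denotes the complement of $G$. $P_5$ is the chordless path on $5$ vertices, $\overline{P_5}$ its complement, $C_5$ the chordless cycle on $5$ vertices, and the Bull is the graph on $\{1,2,3,4,5\}$ with edges $12,23,34,25,35$. A graph is $(P_5,\overline{P_5},C_5)$-free if it has no induced subgraph isomorphic to $P_5$, $\overline{P_5}$ or $C_5$. A graph $G$ is $(P_5,\overline{P_5},Bull)$-sparse if every set of $6$ vertices of $G$ contains at most one $5$-element subset inducing a graph isomorphic to $P_5$, $\overline{P_5}$ or the Bull. A module of a graph $G=(V,E)$ is a set $M\subseteq V$ such that every vertex outside $M$ is adjacent either to all vertices of $M$ or to none of them. $G$ is prime if its only modules are $\emptyset$, the singletons, and $V$. The four types of graphs are as follows. Each contains the vertices $1,2,3,4,5$ inducing the Bull with edges $12,23,34,25,35$, plus further vertices; ''optional'' vertices may be present or absent, independently of each other; the edges listed (restricted to the vertices that are present) are the only ones besides the five Bull edges. Type $G_1$: optional vertices $a,c,d$; edges $a2,a5$; $c1,c2,c3$; $d2,d3,d4$; $ac$. Type $G_2$: vertices $c_0,i_0$ (always present) and optional vertices $a,c$; edges $c_01,c_02,c_03$; $c_0i_0$; $c1,c2,c3$; $a2,a5$; $ac_0$; $ac$. Type $G_3$: vertices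 $c_0,d_0$ (always present) and optional vertices $c,d$; edges $c_01,c_02,c_03$; $d_02,d_03,d_04$; $c_0d_0$; $c1,c2,c3,cc_0$; $d2,d3,d4,dd_0$. Type $G_4$: vertices $c_0,d_0,i_0$ (always present); edges $c_01,c_02,c_03$; $d_02,d_03,d_04$; $c_0d_0$; $i_0c_0,i_0d_0$. *)

(* Defs.v *)
From mathcomp Require Import all_boot.

Set Implicit Arguments.
Unset Strict Implicit.
Unset Printing Implicit Defensive.

Record sgraph := SGraph {
  vertex :> finType;
  adj : rel vertex;
  adj_sym : symmetric adj;
  adj_irrefl : irreflexive adj }.

Section Basics.

Variable G : sgraph.

Definition compl_adj : rel G := fun x y => (x != y) && ~~ adj x y.

Lemma compl_adj_sym : symmetric compl_adj.
Proof. by move=> x y; rewrite /compl_adj eq_sym adj_sym. Qed.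

Lemma compl_adj_irrefl : irreflexive compl_adj.
Proof. by move=> x; rewrite /compl_adj eqxx. Qed.

Definition compl : sgraph := SGraph compl_adj_sym compl_adj_irrefl.

Variable S : {set G}.

Definition induced_adj : rel {x : G | x \in S} :=
  fun x y => adj (val x) (val y).

Lemma induced_adj_sym : symmetric induced_adj.
Proof. by move=> x y; apply: adj_sym. Qed.

Lemma induced_adj_irrefl : irreflexive induced_adj.
Proof. by move=> x; apply: adj_irrefl. Qed.

Definition induced : sgraph := SGraph induced_adj_sym induced_adj_irrefl.

End Basics.

Definition isomorphic (G H : sgraph) : Prop :=
  exists2 f : G -> H, bijective f & {mono f : x y / adj x y}.

Definition induces (G : sgraph) (S : {set G}) (H : sgraph) : Prop :=
  isomorphic (induced S) H.

Definition contains_induced (G H : sgraph) : Prop :=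
  exists S : {set G}, induces S H.

(* The graph on the labels listed in V whose edges are the pairs of E, read as
   unordered.  Pairs of E with an end outside V are ignored. *)
Section LabelledGraph.

Variables (V : seq nat) (E : seq (nat * nat)).

Definition labelled_adj : rel (seq_sub V) := fun x y =>
  (val x != val y) && (((val x, val y) \in E) || ((val y, val x) \in E)).

Lemma labelled_adj_sym : symmetric labelled_adj.
Proof. by move=> x y; rewrite /labelled_adj eq_sym orbC. Qed.

Lemma labelled_adj_irrefl : irreflexive labelled_adj.
Proof. by move=> x; rewrite /labelled_adj eqxx. Qed.

Definition labelled_graph : sgraph :=
  SGraph labelled_adj_sym labelled_adj_irrefl.

End LabelledGraph.

Definition P5 : sgraph :=
  labelled_graph [:: 1; 2; 3; 4; 5] [:: (1, 2); (2, 3); (3, 4); (4, 5)].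

Definition C5 : sgraph :=
  labelled_graph [:: 1; 2; 3; 4; 5]
    [:: (1, 2); (2, 3); (3, 4); (4, 5); (5, 1)].

Definition bull_vertices : seq nat := [:: 1; 2; 3; 4; 5].

Definition bull_edges : seq (nat * nat) :=
  [:: (1, 2); (2, 3); (3, 4); (2, 5); (3, 5)].

Definition Bull : sgraph := labelled_graph bull_vertices bull_edges.

Definition P5_coP5_C5_free (G : sgraph) : Prop :=
  [/\ ~ contains_induced G P5,
      ~ contains_induced G (compl P5)
    & ~ contains_induced G C5].

Definition P5_coP5_Bull_set (G : sgraph) (X : {set G}) : Prop :=
  [\/ induces X P5, induces X (compl P5) | induces X Bull].

Definition P5_coP5_Bull_sparse (G : sgraph) : Prop :=
  forall S : {set G}, #|S| = 6 ->
  forall X Y : {set G},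
    X \subset S -> #|X| = 5 -> P5_coP5_Bull_set X ->
    Y \subset S -> #|Y| = 5 -> P5_coP5_Bull_set Y ->
    X = Y.

Definition is_module (G : sgraph) (M : {set G}) : Prop :=
  forall x : G, x \notin M ->
    (forall y, y \in M -> adj x y) \/ (forall y, y \in M -> ~~ adj x y).

Definition prime_graph (G : sgraph) : Prop :=
  forall M : {set G}, is_module M ->
    [\/ M = set0, exists x : G, M = [set x] | M = [set: G]].

(* Labels of the vertices other than 1, ..., 5 in the four types. *)
Definition va := 6.
Definition vc := 7.
Definition vd := 8.
Definition vc0 := 9.
Definition vd0 := 10.
Definition vi0 := 11.

Definition optional (b : bool) (v : nat) : seq nat := if b then [:: v] else [::].

(* A boolean argument has_v tells whether the optional vertex v is present. *)
Definition G1 (has_a has_c has_d : bool) : sgraph :=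
  labelled_graph
    (bull_vertices ++ optional has_a va ++ optional has_c vc
       ++ optional has_d vd)
    (bull_edges ++
     [:: (va, 2); (va, 5);
         (vc, 1); (vc, 2); (vc, 3);
         (vd, 2); (vd, 3); (vd, 4);
         (va, vc)]).

Definition G2 (has_a has_c : bool) : sgraph :=
  labelled_graph
    (bull_vertices ++ [:: vc0; vi0] ++ optional has_a va ++ optional has_c vc)
    (bull_edges ++
     [:: (vc0, 1); (vc0, 2); (vc0, 3);
         (vc0, vi0);
         (vc, 1); (vc, 2); (vc, 3);
         (va, 2); (va, 5);
         (va, vc0);
         (va, vc)]).

Definition G3 (has_c has_d : bool) : sgraph :=
  labelled_graph
    (bull_vertices ++ [:: vc0; vd0] ++ optional has_c vc ++ optional has_d vd)
    (bull_edges ++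
     [:: (vc0, 1); (vc0, 2); (vc0, 3);
         (vd0, 2); (vd0, 3); (vd0, 4);
         (vc0, vd0);
         (vc, 1); (vc, 2); (vc, 3); (vc, vc0);
         (vd, 2); (vd, 3); (vd, 4); (vd, vd0)]).

Definition G4 : sgraph :=
  labelled_graph
    (bull_vertices ++ [:: vc0; vd0; vi0])
    (bull_edges ++
     [:: (vc0, 1); (vc0, 2); (vc0, 3);
         (vd0, 2); (vd0, 3); (vd0, 4);
         (vc0, vd0);
         (vi0, vc0); (vi0, vd0)]).

Definition of_type_G1_to_G4 (G : sgraph) : Prop :=
  [\/ exists has_a has_c has_d, isomorphic G (G1 has_a has_c has_d),
      exists has_a has_c, isomorphic G (G2 has_a has_c),
      exists has_c has_d, isomorphic G (G3 has_c has_d)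
    | isomorphic G G4].

(* Main.v *)
(* Let H be an induced subgraph of G.  Since G is prime, H is not a module of G
   and neither is any set {u} + {twins of u over H}; hence, unless H = G, H can
   be enlarged either by one vertex x that is neither uniform on H nor a twin
   over H of a vertex of H, or by two vertices x and y such that x is a twin
   over H of some vertex u while y is not, and y distinguishes x from u.  For
   H the Bull or any other graph of the four types or one of their complements
   (all with at most 9 vertices), an exhaustive computation shows that
   every such enlargement that is (P5, co-P5, C5)-free and sparse is again one
   of these graphs, so starting from the Bull the process ends at G itself.
   Conversely each of these graphs is checked to be sparse. *)
Require Import Defs.
From mathcomp Require Import all_boot.

Set Implicit Arguments.
Unset Strict Implicit.
Unset Printing Implicit Defensive.

(* A graph is encoded by an enumeration of its vertices, as the list of rows
   recording the adjacency of each vertex to the later ones.  Vertices are added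
   at the head, so that a tail of a code is the code of an induced subgraph. *)
Fixpoint code (T : Type) (e : rel T) (s : seq T) : seq (seq bool) :=
  if s is x :: s' then [seq e x y | y <- s'] :: code e s' else [::].

Fixpoint edge (g : seq (seq bool)) (i j : nat) : bool :=
  match g, i, j with
  | r :: _, 0, j'.+1 => nth false r j'
  | r :: _, i'.+1, 0 => nth false r i'
  | _ :: g', i'.+1, j'.+1 => edge g' i' j'
  | _, _, _ => false
  end.

Definition compl_code (g : seq (seq bool)) := [seq map negb r | r <- g].

Fixpoint embeddings (p g : seq (seq bool)) : seq (seq nat) :=
  if p is r :: p' then
    [seq v :: t | t <- embeddings p' g,
                  v <- [seq v <- iota 0 (size g) |
                         if v \in t then false else [seq edge g v w | w <- t] == r]]
  else [:: [::]].

Definition codes (G : sgraph) (g : seq (seq bool)) : Prop :=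
  exists s : seq G, [/\ uniq s, s =i G & code (@adj G) s = g].

(** * Codes and induced embeddings *)

Lemma size_code (T : Type) (e : rel T) s : size (code e s) = size s.
Proof. by elim: s => //= x s ->. Qed.

Lemma code_map (T U : Type) (f : T -> U) (e : rel T) (e' : rel U) s :
  {mono f : x y / e x y >-> e' x y} -> code e' (map f s) = code e s.
Proof.
move=> fM; elim: s => //= x s ->; congr (_ :: _).
by rewrite -map_comp; apply: eq_map => y /=; rewrite fM.
Qed.

Lemma edge_code (G : sgraph) (x0 : G) s i j : i < size s -> j < size s ->
  edge (code (@adj G) s) i j = adj (nth x0 s i) (nth x0 s j).
Proof.
elim: s i j => [|x s IHs] [|i] [|j] //=; rewrite ?ltnS.
- by rewrite adj_irrefl.
- by move=> _ lt_j; rewrite (nth_map x0).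
- by move=> lt_i _; rewrite (nth_map x0) // adj_sym.
exact: IHs.
Qed.

Lemma code_nth (G : sgraph) (x0 : G) s t : all (gtn (size s)) t ->
  code (@adj G) (map (nth x0 s) t) = code (edge (code (@adj G) s)) t.
Proof.
elim: t => //= i t IHt /andP[lt_i lt_t]; rewrite IHt //; congr (_ :: _).
rewrite -map_comp; apply/eq_in_map => j /(allP lt_t) lt_j /=.
by rewrite (edge_code x0).
Qed.

Lemma mem_embeddings p g t : (t \in embeddings p g) =
  [&& code (edge g) t == p, uniq t & all (gtn (size g)) t].
Proof.
elim: p t => [|r p IHp] [|v t] //=.
  by apply/negbTE/negP => /allpairsPdep[? [? []]].
apply/allpairsPdep/idP => [[t' [v' []]]|].
  rewrite IHp mem_filter mem_iota => /and3P[/eqP <- Ut lt_t].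
  case: ifP => //= v't /andP[/eqP <- lt_v] [-> ->].
  by rewrite eqxx v't Ut lt_v lt_t.
case/and3P=> /eqP[<- Ep] /andP[vt Ut] /andP[lt_v lt_t].
exists t, v; split=> //; first by rewrite IHp Ep eqxx Ut.
by rewrite mem_filter mem_iota (negbTE vt) eqxx.
Qed.

Lemma embeddings_nth (G : sgraph) (x0 : G) s p t : uniq s ->
    t \in embeddings p (code (@adj G) s) ->
  [/\ uniq (map (nth x0 s) t), {subset map (nth x0 s) t <= s}
    & code (@adj G) (map (nth x0 s) t) = p].
Proof.
move=> Us; rewrite mem_embeddings size_code => /and3P[/eqP <- Ut lt_t].
split; last exact: code_nth.
  rewrite map_inj_in_uniq // => i j /(allP lt_t) lt_i /(allP lt_t) lt_j /eqP.
  by rewrite nth_uniq // => /eqP.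
by move=> _ /mapP[i /(allP lt_t) lt_i ->]; apply: mem_nth.
Qed.

Lemma embeddings_index (G : sgraph) (s u : seq G) :
    uniq u -> {subset u <= s} ->
  map (index^~ s) u \in embeddings (code (@adj G) u) (code (@adj G) s).
Proof.
case: s => [|x0 s]; first by case: u => // x u _ /(_ x (mem_head _ _)).
set s' := x0 :: s => Uu us; have lt_u: all (gtn (size s')) (map (index^~ s') u).
  by rewrite all_map; apply/allP => x /us; rewrite -index_mem.
rewrite mem_embeddings size_code lt_u -(code_nth x0) // -map_comp.
rewrite (_ : map _ u = u); last first.
  rewrite -[RHS]map_id; apply/eq_in_map => x /us xs /=.
  by rewrite (nth_index x0 xs).
rewrite eqxx map_inj_in_uniq ?Uu // => x y /us xs /us ys eq_i.
by rewrite -(nth_index x0 xs) eq_i (nth_index x0 ys).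
Qed.

(** * Codes under isomorphism, complementation and passage to induced subgraphs *)

Lemma codes_iso (G H : sgraph) g : codes G g -> codes H g -> isomorphic G H.
Proof.
case=> s [Us sT sg] [s' [Us' s'T s'g]].
have sz: size s = size s' by rewrite -(size_code (@adj G)) sg -s'g size_code.
(* Empty graphs are treated apart, since [nth] then has no default vertex. *)
case Es: s => [|x0 s1].
  have noG (x : G) : False by have := sT x; rewrite Es.
  have noH (y : H) : False by have := s'T y; case: (s') sz; rewrite ?Es.
  exists (fun x => False_rect H (noG x)) => [|x]; last by case: (noG x).
  by exists (fun y => False_rect G (noH y)) => x; [case: (noG x)|case: (noH x)].
case Es': s' => [|y0 s1']; first by move: sz; rewrite Es Es'.
have lt_s x : index x s < size s by rewrite index_mem sT.
have lt_s' y : index y s' < size s' by rewrite index_mem s'T.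
exists (fun x => nth y0 s' (index x s)) => [|x y]; last first.
  rewrite -edge_code -?sz // s'g -sg (edge_code x0) //.
  by rewrite !nth_index ?sT.
exists (fun y => nth x0 s (index y s')) => [x|y].
  by rewrite index_uniq -?sz // nth_index ?sT.
by rewrite index_uniq ?sz // nth_index ?s'T.
Qed.

Lemma iso_codes (G H : sgraph) g : isomorphic G H -> codes G g -> codes H g.
Proof.
case=> f [f' fK f'K] fM [s [Us sT sg]]; exists (map f s); split.
- by rewrite (map_inj_uniq (can_inj fK)).
- by move=> y; rewrite -(f'K y) (mem_map (can_inj fK)) sT.
- by rewrite (code_map _ fM).
Qed.

(** An enumeration without repetition only pairs distinct vertices, and on these the complement
    negates adjacency. *)
Lemma compl_codes (G : sgraph) g : codes G g -> codes (compl G) (compl_code g).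
Proof.
case=> s [Us sT <-]; exists s; split=> //.
elim: s Us {sT} => //= x s IHs /andP[xs Us]; rewrite IHs //.
congr (_ :: _); rewrite -map_comp; apply/eq_in_map => y ys /=.
by rewrite /compl_adj; case: eqP xs => // ->; rewrite ys.
Qed.

Lemma compl_codeK : involutive compl_code.
Proof. by apply: mapK; apply: mapK; apply: negbK. Qed.

Lemma codes_compl (G : sgraph) g : codes (compl G) g -> codes G (compl_code g).
Proof.
move/compl_codes/iso_codes; apply; exists id => [|x y]; first by exists id.
rewrite /= /compl_adj /= /compl_adj.
by case: eqP => [->|]; rewrite ?adj_irrefl ?negbK.
Qed.

Definition label_rel (E : seq (nat * nat)) : rel nat :=
  fun i j => (i != j) && (((i, j) \in E) || ((j, i) \in E)).

Lemma codes_labelled V E : uniq V ->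
  codes (labelled_graph V E) (code (label_rel E) (rev V)).
Proof.
move=> UV; have eqV := val_seq_sub_enum UV.
exists (rev (seq_sub_enum V)); split.
- by rewrite rev_uniq -(map_inj_uniq val_inj) eqV.
- by move=> x; rewrite mem_rev mem_seq_sub_enum.
- rewrite -[in RHS]eqV -map_rev.
  by rewrite (code_map _ (e := @adj (labelled_graph V E))).
Qed.

(** Trades an isomorphism from a subtype for a list of vertices of [G], the only form the search
    handles. *)
Lemma induces_codes (G H : sgraph) (S : {set G}) h : codes H h ->
  induces S H <->
  exists s : seq G, [/\ uniq s, s =i S & code (@adj G) s = h].
Proof.
move=> Hh; split=> [SH|[s [Us sS sh]]].
  have [f [f' fK f'K] fM] := SH.
  have: codes (induced S) h.
    apply: iso_codes Hh; exists f' => [|x y]; first by exists f.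
    by rewrite -fM !f'K.
  case=> s [Us sT sh]; exists (map val s); split.
  - by rewrite (map_inj_uniq val_inj).
  - move=> x; apply/mapP/idP => [[y _ ->]|xS]; first exact: valP.
    by exists (Sub x xS); rewrite ?sT.
  - by rewrite -sh; apply: code_map.
apply: codes_iso Hh; exists (pmap insub s).
have vs: map val (pmap insub s : seq {x | x \in S}) = s.
  rewrite (pmap_filter (insubK _)); apply/all_filterP/allP => x.
  by rewrite isSome_insub -sS.
split.
- by rewrite pmap_sub_uniq.
- by move=> x; rewrite mem_pmap_sub sS; apply: valP.
- by rewrite -sh -[in RHS]vs (code_map _ (e := @adj (induced S))).
Qed.

(* The argument [id] makes unification recover [V] and [E] from a graph that is
   [labelled_graph V E] up to unfolding.  The order is reversed so that the Bull
   is a tail of every type code. *)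
Definition label_code V E (H : sgraph) of phant_id (labelled_graph V E) H :=
  code (label_rel E) (rev V).
Notation "[ 'code' 'of' H ]" := (@label_code _ _ H id)
  (at level 0, format "[ 'code'  'of'  H ]").

(** * The finite computation *)

Definition P5_code := [code of P5].
Definition C5_code := [code of C5].
Definition Bull_code := [code of Bull].

Definition bools := [:: false; true].

Definition type_codes : seq (seq (seq bool)) :=
  [seq [code of G1 x.1 x.2 y] | x <- allpairs pair bools bools, y <- bools] ++
  [seq [code of G2 x y] | x <- bools, y <- bools] ++
  [seq [code of G3 x y] | x <- bools, y <- bools] ++ [:: [code of G4]].

Definition known_codes := type_codes ++ map compl_code type_codes.

(* Two distinct sets of size 5 lie in a common set of size 6 exactly when the
   first has exactly one element outside the second.  Conditionals are used
   instead of [&&] and [||] here and below because call-by-value evaluation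
   computes both arguments of the latter. *)
Definition valid g :=
  if embeddings P5_code g is _ :: _ then false else
  if embeddings (compl_code P5_code) g is _ :: _ then false else
  if embeddings C5_code g is _ :: _ then false else
  let bulls := embeddings Bull_code g in
  all (fun t => all (fun t' => count [predC t'] t != 1) bulls) bulls.

(* Since validity is hereditary, filtering at each step loses no valid row and
   keeps the search far below the [2 ^ size g] possible rows. *)
Fixpoint valid_rows g : seq (seq bool) :=
  if g is q :: g' then
    [seq r <- [seq b :: r | r <- valid_rows g', b <- bools] |
      valid (r :: g)]
  else [:: [::]].

(** Between codes of equal size an embedding is an isomorphism. *)
Definition known_up_to_iso g :=
  has (fun h => if size h == size g then embeddings h g != [::] else false)
      known_codes.

(** Position [u] is exempt: a twin of [u] may be adjacent to [u] or not. *)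
Definition twin_row g r u :=
  all (fun i => (i == u) || (nth false r i == edge g u i)) (iota 0 (size g)).

Definition invalid_or_known g :=
  if valid g then known_up_to_iso g else true.

(** The conjuncts treat enlargement by one and by two vertices. In the second, [r] is the row of [x]
    and [q] that of [y] over [g]; the bit put before [q] makes [y] distinguish [x] from [u].
    Validity is tested again because [rows] only ensures it for each vertex separately. *)
Definition closed_under_extension g :=
  let rows := valid_rows g in
  all (fun r => if constant r || has (twin_row g r) (iota 0 (size g)) then true
                else known_up_to_iso (r :: g)) rows &&
  all (fun u =>
    let twins := [seq r <- rows | twin_row g r u] in
    let others := [seq r <- rows | ~~ twin_row g r u] in
    all (fun r => all (fun q =>
      invalid_or_known ((~~ nth false q u :: q) :: r :: g)) others) twins)
    (iota 0 (size g)).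

Lemma known_codes_valid : all valid known_codes.
Proof. by vm_cast_no_check (erefl true). Qed.

Lemma known_codes_closed : all closed_under_extension known_codes.
Proof. by vm_cast_no_check (erefl true). Qed.

(** * Codes of the named graphs and of the four types *)

Lemma P5_codes : codes P5 P5_code. Proof. exact: codes_labelled. Qed.
Lemma coP5_codes : codes (compl P5) (compl_code P5_code).
Proof. exact/compl_codes/P5_codes. Qed.
Lemma C5_codes : codes C5 C5_code. Proof. exact: codes_labelled. Qed.
Lemma Bull_codes : codes Bull Bull_code. Proof. exact: codes_labelled. Qed.

Lemma type_codesP G :
  of_type_G1_to_G4 G <-> exists2 g, g \in type_codes & codes G g.
Proof.
have codesG H g : codes H g -> isomorphic G H <-> codes G g.
  move=> Hg; split=> [GH|/codes_iso]; last exact.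
  case: GH => f [f' fK f'K] fM; apply: iso_codes Hg.
  by exists f' => [|x y]; [exists f | rewrite -fM !f'K].
have iso1 a c d: isomorphic G (G1 a c d) <-> codes G [code of G1 a c d].
  by apply/codesG/codes_labelled; case: a c d => [] [] [].
have iso2 a c: isomorphic G (G2 a c) <-> codes G [code of G2 a c].
  by apply/codesG/codes_labelled; case: a c => [] [].
have iso3 c d: isomorphic G (G3 c d) <-> codes G [code of G3 c d].
  by apply/codesG/codes_labelled; case: c d => [] [].
have iso4: isomorphic G G4 <-> codes G [code of G4].
  exact/codesG/codes_labelled.
split=> [|[g]].
  case=> [[a [c [d /iso1]]]|[a [c /iso2]]|[c [d /iso3]]|/iso4] Gg.
  - by exists [code of G1 a c d] => //; case: a c d {Gg} => [] [] [].
  - by exists [code of G2 a c] => //; case: a c {Gg} => [] [].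
  - by exists [code of G3 c d] => //; case: c d {Gg} => [] [].
  - by exists [code of G4].
rewrite mem_cat => /orP[/allpairsP[[[a c] d] [_ _ ->]] /iso1|].
  by constructor 1; exists a, c, d.
rewrite mem_cat => /orP[/allpairsP[[a c] [_ _ ->]] /iso2|].
  by constructor 2; exists a, c.
rewrite mem_cat => /orP[/allpairsP[[c d] [_ _ ->]] /iso3|].
  by constructor 3; exists c, d.
by rewrite inE => /eqP-> /iso4; constructor 4.
Qed.

Lemma known_codesP G :
  of_type_G1_to_G4 G \/ of_type_G1_to_G4 (compl G) <->
  exists2 g, g \in known_codes & codes G g.
Proof.
split=> [[]/type_codesP[g gT Gg]|[g]].
- by exists g => //; rewrite mem_cat gT.
- exists (compl_code g); first by rewrite mem_cat map_f ?orbT.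
  exact: codes_compl.
rewrite mem_cat => /orP[gT Gg|/mapP[h hT ->] Gh].
  by left; apply/type_codesP; exists g.
right; apply/type_codesP; exists h => //.
by rewrite -[h]compl_codeK; apply: compl_codes.
Qed.

(** * Sparseness and validity of codes *)

Lemma code_induces (G H : sgraph) h (s : seq G) : codes H h -> uniq s ->
  code (@adj G) s = h -> induces [set x in s] H.
Proof.
move=> Hh Us sh; apply/(induces_codes _ Hh); exists s; split=> // x.
by rewrite inE.
Qed.

Lemma embeddings_free (G H : sgraph) (x0 : G) h (s : seq G) :
    codes H h -> uniq s -> ~ contains_induced G H ->
  embeddings h (code (@adj G) s) = [::].
Proof.
move=> Hh Us noH; case Et: embeddings => [//|t tt].
have: t \in embeddings h (code (@adj G) s) by rewrite Et mem_head.
case/(embeddings_nth x0 Us) => Ut _ th; case: noH.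
by exists [set x in map (nth x0 s) t]; apply: code_induces th.
Qed.

Lemma card_seq_set (T : finType) (s : seq T) :
  uniq s -> #|[set x in s]| = size s.
Proof. by move/card_uniqP <-; apply: eq_card => x; rewrite inE. Qed.

Lemma count_predC_setD (T : finType) (s t : seq T) : uniq s ->
  count [predC t] s = #|[set x in s] :\: [set x in t]|.
Proof.
move=> Us; rewrite -size_filter -(card_uniqP (filter_uniq _ Us)).
by apply: eq_card => x; rewrite !inE mem_filter.
Qed.

Lemma count_predC_map (T U : eqType) (f : T -> U) (s t : seq T) :
  {in s & t, injective f} ->
  count [predC map f t] (map f s) = count [predC t] s.
Proof.
move=> f_inj; rewrite count_map; apply/eq_in_count => x xs /=.
by congr (~~ _); apply/mapP/idP => [[y yt /f_inj->]//|xt]; exists x.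
Qed.

Lemma cardsU_setD (T : finType) (X Y : {set T}) :
  #|X :|: Y| = #|X :\: Y| + #|Y|.
Proof.
by rewrite -(cardsID Y) setIC setKU setDUl setDv setU0 addnC.
Qed.

(** If one Bull has exactly one vertex outside another, their union has six vertices, and sparseness
    forces the two to coincide, which is absurd. *)
Lemma bull_sparse_valid (G : sgraph) (x0 : G) (s : seq G) :
  P5_coP5_C5_free G -> P5_coP5_Bull_sparse G -> uniq s ->
  valid (code (@adj G) s).
Proof.
move=> [noP noCP noC] Gsp Us.
rewrite /valid (embeddings_free x0 P5_codes) //.
rewrite (embeddings_free x0 coP5_codes) // (embeddings_free x0 C5_codes) //.
apply/allP => t tB; apply/allP => t' t'B.
case: (embeddings_nth x0 Us tB) => Uu us uB.
case: (embeddings_nth x0 Us t'B) => Uu' us' u'B.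
rewrite -(@count_predC_map _ _ (nth x0 s)); last first.
  move=> i j it jt /eqP; move: tB t'B; rewrite !mem_embeddings !size_code.
  case/and3P=> _ _ /allP/(_ i it) lt_i /and3P[_ _ /allP/(_ j jt) lt_j].
  by rewrite nth_uniq // => /eqP.
rewrite count_predC_setD //; apply/eqP => D1.
have card5 u : code (@adj G) u = Bull_code -> uniq u -> #|[set x in u]| = 5.
  by move=> uc Uu0; rewrite card_seq_set // -(size_code (@adj G)) uc.
have X5 := card5 _ uB Uu; have Y5 := card5 _ u'B Uu'.
have := Gsp (_ :|: _) _ _ _ (subsetUl _ _) X5 _ (subsetUr _ _) Y5 _.
rewrite cardsU_setD D1 Y5 => /(_ erefl) E.
move/eqP: D1; rewrite E ?setDv ?cards0 //; constructor 3;
  exact: code_induces Bull_codes _ _.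
Qed.

Lemma valid_bull_sparse (G : sgraph) g :
  P5_coP5_C5_free G -> codes G g -> valid g -> P5_coP5_Bull_sparse G.
Proof.
case=> noP noCP noC [s [Us sG <-]] Gv S S6 X Y XS X5 XB YS Y5 YB.
case: XB => [XP|XP|]; [by case: noP; exists X|by case: noCP; exists X|].
case: YB => [YP|YP|]; [by case: noP; exists Y|by case: noCP; exists Y|].
case/(induces_codes _ Bull_codes)=> v [Uv vY vB].
case/(induces_codes _ Bull_codes)=> u [Uu uX uB].
have all_s (w : seq G) : {subset w <= s} by move=> x _; rewrite sG.
have uE := embeddings_index Uu (all_s u).
have vE := embeddings_index Uv (all_s v).
rewrite uB in uE; rewrite vB in vE; move: Gv; rewrite /valid.
case: (embeddings P5_code _) => //; case: (embeddings (compl_code _) _) => //.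
case: (embeddings C5_code _) => // /allP/(_ _ uE) /allP/(_ _ vE).
rewrite count_predC_map; last first.
  move=> x y _ _ /(congr1 (nth x s)); rewrite !nth_index ?sG //.
rewrite count_predC_setD //.
have -> : [set x in u] = X by apply/setP => x; rewrite inE uX.
have -> : [set x in v] = Y by apply/setP => x; rewrite inE vY.
move=> D1; apply/eqP; rewrite eqEcard X5 Y5 leqnn andbT.
rewrite -setD_eq0 -cards_eq0.
(* Inside a set of size 6 at most one element of [X] lies outside [Y]; validity excludes exactly
   one. *)
have: #|X :|: Y| <= 6 by rewrite -S6 subset_leq_card // subUset XS.
by rewrite cardsU_setD Y5 addnC; case: #|X :\: Y| D1 => [|[|n]].
Qed.

(** * Enlarging an induced subgraph of a prime graph *)

Definition twin (G : sgraph) (s : seq G) (u x : G) :=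
  all (fun z => (z == u) || (adj x z == adj u z)) s.

(** When neither enlargement exists, a module appears: some [u] with its twins outside [s] if there
    are any, otherwise [s] itself. Primality excludes the former and makes the latter everything. *)
Lemma prime_extension (G : sgraph) (s : seq G) :
    prime_graph G -> uniq s -> 1 < size s ->
  [\/ s =i G,
      exists x, [&& x \notin s, ~~ constant (map (adj x) s)
                  & ~~ has (fun u => twin s u x) s]
    | exists u x y, [/\ u \in s, x \notin s /\ y \notin s,
        twin s u x, ~~ twin s u y & adj y x != adj y u]].
Proof.
move=> Gprime Us s_gt1.
have [/existsP ex2|noext1] := boolP [exists x, [&& x \notin s,
  ~~ constant (map (adj x) s) & ~~ has (fun u => twin s u x) s]].
  by constructor 2.
have [|noext2] := boolP [exists u, exists x, exists y, [&& u \in s, x \notin s,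
  y \notin s, twin s u x, ~~ twin s u y & adj y x != adj y u]].
  case/existsP=> u /existsP[x /existsP[y /and5P[us xs ys ux /andP[uy yxu]]]].
  by constructor 3; exists u, x, y.
constructor 1; have [/existsP[u /andP[us /existsP[x /andP[xs ux]]]]|notwin] :=
  boolP [exists u, (u \in s) && [exists x, (x \notin s) && twin s u x]].
  pose M := u |: [set z | z \notin s & twin s u z].
  have Mmod : is_module M.
    move=> y; rewrite !inE negb_or => /andP[yu yM].
    have yE z : z \in M -> adj y z = adj y u.
      rewrite !inE => /orP[/eqP->//|/andP[zs uz]].
      (* Inside [s], being a twin decides. Outside [s], [y] is not a twin of [u], so by [noext2] it
         cannot distinguish [z] from [u]. *)
      have [ys|ys] := boolP (y \in s).
        have /orP[/eqP yu'|/eqP] := allP uz y ys.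
          by rewrite yu' eqxx in yu.
        by rewrite !(adj_sym y).
      rewrite ys /= in yM; apply/eqP/negbNE/negP => yzu.
      case/negP: noext2; apply/existsP; exists u; apply/existsP; exists z.
      by apply/existsP; exists y; rewrite us zs ys uz yM yzu.
    by case: (boolP (adj y u)) => yu1; [left|right] => z /yE ->.
  have uM : u \in M by rewrite !inE eqxx.
  have xM : x \in M by rewrite !inE xs ux orbT.
  have xu : x != u by apply: contraNneq xs => ->.
  case: (Gprime M Mmod) => [M0|[w Mw]|MT].
  - by rewrite M0 inE in uM.
  - by move: xM uM xu; rewrite Mw !inE => /eqP-> /eqP->; rewrite eqxx.
  (* All twins in [M] lie outside [s], so [M] being everything would leave only [u] in [s]. *)
  have: {subset s <= [:: u]}.
    move=> z zs; have: z \in M by rewrite MT inE.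
    by rewrite !inE zs orbF.
  by move/(uniq_leq_size Us); rewrite leqNgt s_gt1.
have: is_module [set z in s].
  move=> x; rewrite inE => xs.
  have: constant (map (adj x) s).
    apply/negbNE/negP => xN; case/negP: noext1; apply/existsP; exists x.
    rewrite xs xN /=; apply/hasPn => u us; apply/negP => ux.
    case/negP: notwin; apply/existsP; exists u; rewrite us.
    by apply/existsP; exists x; rewrite xs.
  case/(constantP true)=> b sb.
  have adjE y : y \in s -> adj x y = b.
    by move=> ys; have := map_f (adj x) ys; rewrite sb => /nseqP[].
  by case: b adjE {sb} => adjE; [left|right] => y; rewrite inE => /adjE->.
case/Gprime => [s0|[w sw]|sT] x.
- by case: (s) s_gt1 s0 => // z t _ /setP/(_ z); rewrite !inE eqxx.
- have: {subset s <= [:: w]}.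
    by move=> z zs; move/setP/(_ z): sw; rewrite !inE zs.
  by move/(uniq_leq_size Us); rewrite leqNgt s_gt1.
by move/setP/(_ x): sT; rewrite !inE => ->.
Qed.

Lemma valid_rows_cons q g : valid_rows (q :: g) =
  [seq r <- [seq b :: r | r <- valid_rows g, b <- bools] | valid (r :: q :: g)].
Proof. by []. Qed.

Lemma twin_rowE (G : sgraph) (x0 : G) (s : seq G) x i : uniq s -> i < size s ->
  twin_row (code (@adj G) s) (map (adj x) s) i = twin s (nth x0 s i) x.
Proof.
move=> Us lt_i; rewrite /twin -[X in all _ X](mkseq_nth x0) all_map.
rewrite /twin_row size_code; apply: eq_in_all => j.
rewrite mem_iota => /= lt_j; rewrite nth_uniq // (nth_map x0) //.
by rewrite (edge_code x0).
Qed.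

(** The code of [x] followed by any tail of [s] is valid, so the row of [x] survives every filtering
    stage. *)
Lemma mem_valid_rows (G : sgraph) (s : seq G) x :
    P5_coP5_C5_free G -> P5_coP5_Bull_sparse G -> uniq (x :: s) ->
  map (adj x) s \in valid_rows (code (@adj G) s).
Proof.
move=> Gfree Gsp; elim: s => [|y s IHs] // Uxys.
have Uxs : uniq (x :: s).
  by apply: subseq_uniq Uxys; rewrite /= eqxx; apply: subseq_cons.
have valid_xys := bull_sparse_valid x Gfree Gsp Uxys.
rewrite valid_rows_cons mem_filter valid_xys andTb.
apply/allpairsP; exists (map (adj x) s, adj x y).
by split; [exact: IHs|case: adj|].
Qed.

(** Reordering [s] along the embedding makes its code literally a known one, so that the enlargement
    can be iterated. *)
Lemma known_up_to_isoP (G : sgraph) (x0 : G) (s : seq G) : uniq s ->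
    known_up_to_iso (code (@adj G) s) ->
  exists t : seq G,
    [/\ uniq t, size t = size s & code (@adj G) t \in known_codes].
Proof.
move=> Us /hasP[h hk]; case: eqP => // sz_h.
case Et: (embeddings h _) => [//|t tt] _.
have: t \in embeddings h (code (@adj G) s) by rewrite Et mem_head.
case/(embeddings_nth x0 Us) => Ut _ th; exists (map (nth x0 s) t).
by rewrite Ut th -(size_code (@adj G)) th sz_h size_code.
Qed.

Lemma known_code_size g : g \in known_codes -> 1 < size g.
Proof. by apply/allP: g; vm_compute. Qed.

Lemma known_code_extension (G : sgraph) (s : seq G) :
    prime_graph G -> P5_coP5_C5_free G -> P5_coP5_Bull_sparse G ->
    uniq s -> code (@adj G) s \in known_codes -> ~ s =i G ->
  exists t : seq G,
    [/\ uniq t, size s < size t & code (@adj G) t \in known_codes].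
Proof.
move=> Gprime Gfree Gsp Us sk sNT.
have s_gt1 := known_code_size sk; rewrite size_code in s_gt1.
have [x0 _] : exists x0, x0 \in s.
  by case: (s) s_gt1 => // x t _; exists x; rewrite mem_head.
have valid_adj x : x \notin s -> map (adj x) s \in valid_rows (code (@adj G) s).
  by move=> xs; apply: mem_valid_rows; rewrite //= xs.
suff [t [Ut lt_st /(known_up_to_isoP x0 Ut) [t' [Ut' sz_t' t'k]]]] :
  exists t : seq G, [/\ uniq t, size s < size t
                      & known_up_to_iso (code (@adj G) t)].
  by exists t'; rewrite sz_t'.
have /allP/(_ _ sk)/andP[] := known_codes_closed.
rewrite size_code => /allP closed1 /allP closed2.
case: (prime_extension Gprime Us s_gt1) => [//|[x /and3P[xs xN xT]]|].
  exists (x :: s); split; rewrite //= ?xs //.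
  move: (closed1 _ (valid_adj x xs)); rewrite (negbTE xN) orFb.
  case: hasP => // -[i]; rewrite mem_iota => /= lt_i.
  rewrite (twin_rowE x0) // => ux; case/hasP: xT; exists (nth x0 s i) => //.
  exact: mem_nth.
case=> u [x [y [us [xs ys] ux uy yxu]]].
have lt_u : index u s < size s by rewrite index_mem.
have xy : y != x by apply: contraNneq uy => ->.
have Ut : uniq [:: y, x & s] by rewrite /= inE negb_or xy ys xs.
exists [:: y, x & s]; split=> //=.
have /closed2 : index u s \in iota 0 (size s) by rewrite mem_iota.
move/allP/(_ (map (adj x) s)); rewrite mem_filter (twin_rowE x0) // nth_index //.
rewrite ux valid_adj // => /(_ isT).
move/allP/(_ (map (adj y) s)); rewrite mem_filter (twin_rowE x0) // nth_index //.
rewrite uy valid_adj // => /(_ isT).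
(* As [y] distinguishes [x] from [u], its adjacency to [x] is the bit that the search prepends. *)
have -> : ~~ nth false (map (adj y) s) (index u s) = adj y x.
  by rewrite (nth_map x0) // nth_index //; case: (adj y x) yxu; case: (adj y u).
by rewrite /invalid_or_known (bull_sparse_valid x0 Gfree Gsp Ut).
Qed.

Theorem theorem3p3 (G : sgraph) (hprime : prime_graph G)
    (hfree : P5_coP5_C5_free G) (hbull : contains_induced G Bull) :
  P5_coP5_Bull_sparse G <->
  (of_type_G1_to_G4 G \/ of_type_G1_to_G4 (compl G)).
Proof.
split=> [hsparse|/known_codesP[g gk Gg]]; last first.
  exact: valid_bull_sparse hfree Gg (allP known_codes_valid g gk).
apply/known_codesP.
have [S /(induces_codes _ Bull_codes) [s [Us _ sB]]] := hbull.
(* The Bull is the graph of type [G1] with no optional vertex. *)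
have {sB} sk : code (@adj G) s \in known_codes by rewrite sB; vm_compute.
(* Induction on the number of vertices of [G] not yet covered. *)
have [n le_n] := ubnP (#|G| - size s).
elim: n s Us sk le_n => // n IHn s Us sk le_n.
have [/forallP sT|sNT] := boolP [forall x, x \in s].
  by exists (code (@adj G) s) => //; exists s; split=> // x; rewrite sT.
have [|t [Ut lt_st tk]] := known_code_extension hprime hfree hsparse Us sk.
  by move=> sT; case/negP: sNT; apply/forallP => x; rewrite sT.
apply: (IHn t Ut tk); apply: leq_trans (le_n : _ <= n); rewrite ltn_sub2l //.
by apply: leq_trans lt_st _; rewrite -(card_uniqP Ut) max_card.
Qed.
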